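(* Let $k,r$ be positive integers, $a,b$ real numbers, $x$ a real number with $1+ax\neq0$, and $\overline{\alpha}_r=(\alpha_0,\dots,\alpha_{r-1})$ nonzero complex numbers; write $\frac{1}{\overline{\alpha}_r}=(\frac{1}{\alpha_0},\dots,\frac{1}{\alpha_{r-1}})$. Then for all $n\in\mathbb{N}_0$, $$P^{(a,b)}_{n}(x;k,r)=\frac{\prod_{i=0}^{r-1}\alpha_{i}}{(rk)!}\left(\frac{x}{1+ax}\right)^{rk}\sum_{j=0}^{r}s\left(r,j;\frac{1}{\overline{\alpha}_{r}}\right)\sum_{\ell=0}^{n}j^{n-\ell}\binom{n}{\ell}M^{(r)}_{\ell}\left(\frac{1+bx}{1+ax};k;\overline{\alpha}_{r}\right),$$ with the convention $0^0=1$.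
   Context: The unified Bernstein and Bleimann–Butzer–Hahn basis $P^{(a,b)}_n(x;k,r)$ is defined by $$\left(\frac{2^{1-k}x^{k}t^{k}}{(1+ax)^{k}}\right)^{r}\frac{1}{(rk)!}e^{t\frac{1+bx}{1+ax}}=\sum_{n=0}^{\infty}P^{(a,b)}_{n}(x;k,r)\frac{t^{n}}{n!}.$$ The polynomials $M^{(r)}_{n}(y;k;\overline{\alpha}_{r})$ are the Taylor coefficients at $t=0$ of $$\frac{t^{rk}2^{r(1-k)}e^{yt}}{\prod_{i=0}^{r-1}(\alpha_i e^t-1)}=\sum_{n=0}^{\infty}M^{(r)}_{n}(y;k;\overline{\alpha}_{r})\frac{t^{n}}{n!},$$ the parameters being assumed such that this function is analytic near $t=0$. For complex numbers $\overline{\beta}_r=(\beta_0,\dots,\beta_{r-1})$, the generalized Stirling numbers of the first kind $s(r,j;\overline{\beta}_r)$ are defined by $(z-\beta_0)(z-\beta_1)\cdots(z-\beta_{r-1})=\sum_{j=0}^{r}s(r,j;\overline{\beta}_r)z^j$. *)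

(* Defs.v *)
From Stdlib Require Import Arith Factorial Reals ClassicalEpsilon.
From Coquelicot Require Import Coquelicot.

Open Scope C_scope.

Definition Cexp (z : C) : C :=
  (exp (Re z) * cos (Im z), exp (Re z) * sin (Im z))%R.

(* f_0 * ... * f_(n-1); note that [sum_n a n] has n+1 terms. *)
Fixpoint Cprod (n : nat) (f : nat -> C) : C :=
  match n with
  | O => 1
  | S m => Cprod m f * f m
  end.

Definition Csum (f : nat -> C) (n : nat) : C := @sum_n C_AbelianMonoid f n.

(* f(t) = sum_n c_n t^n / n! for all complex t near 0.  The point t = 0 is left
   out because the closed form of f may be a 0/0 there (a removable
   singularity); the values at t <> 0 still determine c. *)
Definition has_egf (f : C -> C) (c : nat -> C) : Prop :=
  exists rho : R, (0 < rho)%R /\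
    forall t : C, t <> 0 -> (Cmod t < rho)%R ->
      @is_pseries C_AbsRing C_NormedModule
        (fun n => c n / RtoC (INR (fact n))) t (f t).

Definition analytic_near_0 (f : C -> C) : Prop :=
  exists c : nat -> C, has_egf f c.

(* The n! * [t^n] coefficients of f at 0; a junk value if f is not analytic. *)
Definition egf_coeff (f : C -> C) : nat -> C :=
  epsilon (inhabits (fun _ : nat => RtoC 0)) (has_egf f).

Definition P_gf (a b x : R) (k r : nat) (t : C) : C :=
  (RtoC (powerRZ 2 (1 - Z.of_nat k)) * RtoC x ^ k * t ^ k
     / RtoC (1 + a * x) ^ k) ^ r
  * (1 / RtoC (INR (fact (r * k))))
  * Cexp (t * RtoC ((1 + b * x) / (1 + a * x))).

Definition P (a b : R) (n : nat) (x : R) (k r : nat) : C :=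
  egf_coeff (P_gf a b x k r) n.

(* Only the values alpha 0, ..., alpha (r-1) matter. *)
Definition M_gf (r : nat) (y : C) (k : nat) (alpha : nat -> C) (t : C) : C :=
  t ^ (r * k)
  * RtoC (powerRZ 2 (Z.of_nat r * (1 - Z.of_nat k)))
  * Cexp (y * t)
  / Cprod r (fun i => alpha i * Cexp t - 1).

Definition M (r n : nat) (y : C) (k : nat) (alpha : nat -> C) : C :=
  egf_coeff (M_gf r y k alpha) n.

Definition is_stirling1 (r : nat) (beta : nat -> C) (s : nat -> C) : Prop :=
  forall z : C,
    Cprod r (fun i => z - beta i) = Csum (fun j => s j * z ^ j) r.

Definition stirling1 (r j : nat) (beta : nat -> C) : C :=
  epsilon (inhabits (fun _ : nat => RtoC 0)) (is_stirling1 r beta) j.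

Lemma stirling1_spec (r : nat) (beta : nat -> C) :
  is_stirling1 r beta (fun j => stirling1 r j beta).
Proof.
apply (epsilon_spec (inhabits (fun _ : nat => RtoC 0)) (is_stirling1 r beta)).
induction r as [|r [s Hs]].
- exists (fun _ => 1); intro z; unfold Csum; simpl; rewrite sum_O; ring.
- set (s0 := fun j => if Nat.leb j r then s j else 0).
  exists (fun j => (match j with O => 0 | S i => s0 i end) - beta r * s0 j).
  intro z; simpl Cprod; rewrite Hs.
  assert (E : forall m, Csum (fun j => s0 j * z ^ j) m * z =
    Csum (fun j => (match j with O => 0 | S i => s0 i end) * z ^ j) (S m)).
  { unfold Csum; induction m as [|m IH].
    - rewrite sum_Sn, !sum_O; unfold plus; simpl; ring.
    - rewrite sum_Sn, sum_Sn, <- IH; unfold plus; simpl; ring. }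
  assert (F : forall m, Csum (fun j =>
      ((match j with O => 0 | S i => s0 i end) - beta r * s0 j) * z ^ j) m
    = Csum (fun j => (match j with O => 0 | S i => s0 i end) * z ^ j) m
      - beta r * Csum (fun j => s0 j * z ^ j) m).
  { unfold Csum; induction m as [|m IH].
    - rewrite !sum_O; simpl; ring.
    - rewrite !sum_Sn, IH; unfold plus; simpl; ring. }
  assert (G : Csum (fun j => s j * z ^ j) r = Csum (fun j => s0 j * z ^ j) r).
  { apply sum_n_ext_loc; intros j Hj; unfold s0.
    now rewrite (proj2 (Nat.leb_le j r) Hj). }
  assert (L : Csum (fun j => s0 j * z ^ j) (S r)
    = Csum (fun j => s0 j * z ^ j) r).
  { unfold Csum at 1; rewrite sum_Sn.
    replace (s0 (S r)) with (RtoC 0)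
      by (unfold s0; now rewrite (proj2 (Nat.leb_gt (S r) r) (Nat.lt_succ_diag_r r))).
    unfold Csum, plus; simpl; ring. }
  rewrite F, L, <- E, <- G; ring.
Qed.

(* Main.v *)
(* Setting z = e^t in the definition of the Stirling numbers and multiplying by
   prod_i alpha_i gives
     prod_i (alpha_i e^t - 1) = (prod_i alpha_i) sum_j s(r,j;1/alpha) e^(jt),
   so the generating function of P is a constant times
   sum_j s(r,j;1/alpha) e^(jt) times the generating function of M, and the
   formula follows by comparing coefficients. Coefficients are determined by
   small real t <> 0, so the Cauchy products with e^(jt) and the uniqueness of
   coefficients reduce to real power series for the real and imaginary parts. *)
Require Import Defs.
From Stdlib Require Import ZArith Factorial Reals Lia Lra Classical ClassicalEpsilon.
From Coquelicot Require Import Coquelicot.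
Open Scope C_scope.

(** * Complex series by components *)

Notation is_Cseries := (@is_series C_AbsRing C_NormedModule).

Lemma sum_n_C (a : nat -> C) (n : nat) :
  @sum_n C_AbelianMonoid a n =
  (sum_n (fun i => Re (a i)) n, sum_n (fun i => Im (a i)) n).
Proof.
induction n as [|n IH].
- rewrite !sum_O; now destruct (a O).
- now rewrite !sum_Sn, IH.
Qed.

(** Balls in [C] are products of real balls, so limits of partial sums can be taken
    componentwise. *)
Lemma is_Cseries_Re_Im (a : nat -> C) (l : C) :
  is_Cseries a l <->
  is_series (fun n => Re (a n)) (Re l) /\ is_series (fun n => Im (a n)) (Im l).
Proof.
unfold is_series; split.
- intro H; split.
  + apply filterlim_ext with (fun n => fst (@sum_n C_AbelianMonoid a n)).
    { intro n; now rewrite sum_n_C. }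
    eapply filterlim_comp; [exact H|].
    intros Q [eps HQ]; exists eps; intros y [Hy _]; now apply HQ.
  + apply filterlim_ext with (fun n => snd (@sum_n C_AbelianMonoid a n)).
    { intro n; now rewrite sum_n_C. }
    eapply filterlim_comp; [exact H|].
    intros Q [eps HQ]; exists eps; intros y [_ Hy]; now apply HQ.
- intros [HR HI].
  apply filterlim_ext with (fun n =>
    (sum_n (fun i => Re (a i)) n, sum_n (fun i => Im (a i)) n)).
  { intro n; symmetry; apply sum_n_C. }
  apply (proj2 (@filterlim_locally nat C_UniformSpace eventually _ _ l)).
  intro eps.
  apply (filter_imp (F := eventually)) with (2 := filter_and _ _
    (proj1 (filterlim_locally _ _) HR eps) (proj1 (filterlim_locally _ _) HI eps)).
  intros n [H1 H2]; now split.
Qed.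

Lemma is_Cseries_ext (a b : nat -> C) (l m : C) :
  (forall n, a n = b n) -> l = m -> is_Cseries a l -> is_Cseries b m.
Proof. intros H <-; now apply is_series_ext. Qed.

Lemma INR_fact_C_neq_0 (n : nat) : RtoC (INR (fact n)) <> 0.
Proof. intro H; apply (INR_fact_neq_0 n); now apply RtoC_inj. Qed.

Lemma Cdiv_RtoC (z : C) (x : R) :
  x <> 0%R -> z / RtoC x = (Re z / x, Im z / x)%R.
Proof. intro Hx; destruct z; unfold Cdiv, Cinv, Cmult; simpl; f_equal; now field. Qed.

Lemma Re_scal (u : R) (z : C) : Re (RtoC u * z) = (u * Re z)%R.
Proof. destruct z; simpl; ring. Qed.

Lemma Im_scal (u : R) (z : C) : Im (RtoC u * z) = (u * Im z)%R.
Proof. destruct z; simpl; ring. Qed.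

(** * The complex exponential series *)

(** The terms of a convergent series tend to 0, which fails strictly outside the disk of
    convergence; hence [Rabs x] is at most the radius. *)
Lemma CV_radius_gt (a : nat -> R) (x y : R) :
  (Rabs y < Rabs x)%R -> ex_pseries a x -> Rbar_lt (Rabs y) (CV_radius a).
Proof.
intros Hyx Hx; apply Rbar_lt_le_trans with (Rabs x); [exact Hyx|].
apply Rbar_not_lt_le; intro H; apply (CV_disk_outside a x H).
apply is_lim_seq_ext with (2 := ex_series_lim_0 _ Hx).
intro n; unfold scal; simpl; unfold mult; simpl.
rewrite pow_n_pow; ring.
Qed.

(** Comparison with the series of [exp (m * Rabs x)]. *)
Lemma ex_pseries_exp_dominated (a : nat -> R) (m x : R) :
  (forall n, Rabs (a n) <= m ^ n / INR (fact n))%R -> ex_pseries a x.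
Proof.
intro Ha.
apply (@ex_series_le R_AbsRing R_CompleteNormedModule) with
  (fun n => scal (pow_n (m * Rabs x)%R n) (/ INR (fact n))%R).
2: exists (exp (m * Rabs x)); apply is_exp_Reals.
intro n; unfold norm, scal; simpl; unfold abs, mult; simpl.
rewrite !pow_n_pow, Rabs_mult, <- RPow_abs, Rpow_mult_distr.
apply Rle_trans with (Rabs x ^ n * (m ^ n / INR (fact n)))%R.
- apply Rmult_le_compat_l; [apply pow_le, Rabs_pos|apply Ha].
- right; field; apply INR_fact_neq_0.
Qed.

Lemma Rabs_Re_pow_le (z : C) (n : nat) :
  (Rabs (Re (z ^ n) / INR (fact n)) <= Cmod z ^ n / INR (fact n))%R.
Proof.
unfold Rdiv; rewrite Rabs_mult, (Rabs_pos_eq (/ _)).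
- apply Rmult_le_compat_r; [left; apply Rinv_0_lt_compat, INR_fact_lt_0|].
  rewrite <- Cmod_pow; eapply Rle_trans; [|apply Rmax_Cmod]; apply Rmax_l.
- left; apply Rinv_0_lt_compat, INR_fact_lt_0.
Qed.

Lemma Rabs_Im_pow_le (z : C) (n : nat) :
  (Rabs (Im (z ^ n) / INR (fact n)) <= Cmod z ^ n / INR (fact n))%R.
Proof.
unfold Rdiv; rewrite Rabs_mult, (Rabs_pos_eq (/ _)).
- apply Rmult_le_compat_r; [left; apply Rinv_0_lt_compat, INR_fact_lt_0|].
  rewrite <- Cmod_pow; eapply Rle_trans; [|apply Rmax_Cmod]; apply Rmax_r.
- left; apply Rinv_0_lt_compat, INR_fact_lt_0.
Qed.

Lemma CV_radius_entire (a : nat -> R) (x : R) :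
  (forall y, ex_pseries a y) -> Rbar_lt (Rabs x) (CV_radius a).
Proof.
intro H; apply CV_radius_gt with (Rabs x + 1)%R; [|apply H].
rewrite (Rabs_pos_eq (_ + _)); pose proof (Rabs_pos x); lra.
Qed.

Lemma INR_fact_S (n : nat) : INR (fact (S n)) = (INR (S n) * INR (fact n))%R.
Proof. now rewrite fact_simpl, mult_INR. Qed.

(* The system says (p + i q)' = (al + i be) (p + i q), so the components of
   exp (- (al + i be) x) (p + i q) are constant. *)
Lemma linear_ode_rotation (al be : R) (p q : R -> R) :
  (forall x, is_derive p x (al * p x - be * q x)%R) ->
  (forall x, is_derive q x (be * p x + al * q x)%R) ->
  p 0 = 1%R -> q 0 = 0%R ->
  p 1 = (exp al * cos be)%R /\ q 1 = (exp al * sin be)%R.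
Proof.
intros Dp Dq p0 q0.
assert (Ip : forall x, ex_derive (fun y => p y) x) by (intro x; eexists; apply Dp).
assert (Iq : forall x, ex_derive (fun y => q y) x) by (intro x; eexists; apply Dq).
set (g := fun x => (exp (- (al * x)) * (cos (be * x) * p x + sin (be * x) * q x))%R).
set (h := fun x => (exp (- (al * x)) * (cos (be * x) * q x - sin (be * x) * p x))%R).
assert (Dg : forall x, is_derive g x 0%R).
{ intro x; unfold g; auto_derive.
  - pose proof (Ip x); pose proof (Iq x); tauto.
  - replace (Derive (fun x0 : R => p x0) x) with (al * p x - be * q x)%R
      by (symmetry; exact (is_derive_unique _ _ _ (Dp x))).
    replace (Derive (fun x0 : R => q x0) x) with (be * p x + al * q x)%R
      by (symmetry; exact (is_derive_unique _ _ _ (Dq x))).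
    ring. }
assert (Dh : forall x, is_derive h x 0%R).
{ intro x; unfold h; auto_derive.
  - pose proof (Ip x); pose proof (Iq x); tauto.
  - replace (Derive (fun x0 : R => p x0) x) with (al * p x - be * q x)%R
      by (symmetry; exact (is_derive_unique _ _ _ (Dp x))).
    replace (Derive (fun x0 : R => q x0) x) with (be * p x + al * q x)%R
      by (symmetry; exact (is_derive_unique _ _ _ (Dq x))).
    ring. }
assert (g1 : g 1 = 1%R).
{ rewrite <- (@eq_is_derive R_NormedModule g 0 1); [|intros; apply Dg|lra].
  unfold g; rewrite p0, q0, !Rmult_0_r, Ropp_0, exp_0, cos_0; ring. }
assert (h1 : h 1 = 0%R).
{ rewrite <- (@eq_is_derive R_NormedModule h 0 1); [|intros; apply Dh|lra].
  unfold h; rewrite p0, q0, !Rmult_0_r, Ropp_0, exp_0, sin_0; ring. }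
unfold g, h in g1, h1; rewrite !Rmult_1_r, exp_Ropp in g1, h1.
pose proof (exp_pos al) as He; pose proof (sin2_cos2 be) as Hsc; unfold Rsqr in Hsc.
assert (g2 : (cos be * p 1 + sin be * q 1 = exp al)%R).
{ apply Rmult_eq_reg_l with (/ exp al)%R; [rewrite g1; field; lra|].
  apply Rinv_neq_0_compat; lra. }
assert (h2 : (cos be * q 1 - sin be * p 1 = 0)%R).
{ apply Rmult_eq_reg_l with (/ exp al)%R; [rewrite h1; ring|].
  apply Rinv_neq_0_compat; lra. }
(* The rotation by [be] in [g2] and [h2] is inverted by means of [sin^2 + cos^2 = 1]. *)
assert (Ep : (p 1 = exp al * cos be)%R).
{ rewrite <- g2; transitivity (p 1 * (sin be * sin be + cos be * cos be)
    + sin be * (cos be * q 1 - sin be * p 1))%R; [rewrite Hsc, h2|]; ring. }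
assert (Eq : (q 1 = exp al * sin be)%R).
{ rewrite <- g2; transitivity (q 1 * (sin be * sin be + cos be * cos be)
    - cos be * (cos be * q 1 - sin be * p 1))%R; [rewrite Hsc, h2|]; ring. }
now split.
Qed.

(** [Cexp] is built from real functions, so its power series has to be proved. Along real [x], the
    components [p] and [q] of the sum of [z^n x^n / n!] satisfy the system of [linear_ode_rotation]
    by termwise differentiation; the claim is their value at [x = 1]. *)
Lemma is_Cseries_Cexp (z : C) :
  is_Cseries (fun n => z ^ n / RtoC (INR (fact n))) (Cexp z).
Proof.
set (a := fun n => (Re (z ^ n) / INR (fact n))%R).
set (b := fun n => (Im (z ^ n) / INR (fact n))%R).
assert (Ha : forall x, ex_pseries a x).
{ intro x; apply ex_pseries_exp_dominated with (Cmod z); apply Rabs_Re_pow_le. }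
assert (Hb : forall x, ex_pseries b x).
{ intro x; apply ex_pseries_exp_dominated with (Cmod z); apply Rabs_Im_pow_le. }
set (p := PSeries a); set (q := PSeries b).
set (al := Re z); set (be := Im z).
assert (Dp : forall x, is_derive p x (al * p x - be * q x)%R).
{ intro x; replace (al * p x - be * q x)%R with (PSeries (PS_derive a) x).
  - now apply is_derive_PSeries, CV_radius_entire.
  - apply is_pseries_unique.
    apply is_pseries_ext with (PS_minus (PS_scal al a) (PS_scal be b)).
    (* Expanding [Re (z * z ^ n)] gives the left side; the factor [S n] from differentiation cancels
       against [fact (S n)]. *)
    + intro n; change (al * a n - be * b n = INR (S n) * a (S n))%R.
      unfold a, b; rewrite INR_fact_S, Cpow_S.
      replace (Re (z * z ^ n)) with (al * Re (z ^ n) - be * Im (z ^ n))%R by easy.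
      field.
      split; [apply INR_fact_neq_0|apply not_0_INR; lia].
    + apply (@is_pseries_minus R_AbsRing R_NormedModule _ _ x (al * p x)%R (be * q x)%R);
        apply (@is_pseries_scal R_AbsRing R_NormedModule);
        (apply Rmult_comm || now apply PSeries_correct). }
assert (Dq : forall x, is_derive q x (be * p x + al * q x)%R).
{ intro x; replace (be * p x + al * q x)%R with (PSeries (PS_derive b) x).
  - now apply is_derive_PSeries, CV_radius_entire.
  - apply is_pseries_unique.
    apply is_pseries_ext with (PS_plus (PS_scal be a) (PS_scal al b)).
    + intro n; change (be * a n + al * b n = INR (S n) * b (S n))%R.
      unfold a, b; rewrite INR_fact_S, Cpow_S.
      replace (Im (z * z ^ n)) with (al * Im (z ^ n) + be * Re (z ^ n))%R by easy.
      field.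
      split; [apply INR_fact_neq_0|apply not_0_INR; lia].
    + apply (@is_pseries_plus R_AbsRing R_NormedModule _ _ x (be * p x)%R (al * q x)%R);
        apply (@is_pseries_scal R_AbsRing R_NormedModule);
        (apply Rmult_comm || now apply PSeries_correct). }
assert (p0 : p 0 = 1%R).
{ unfold p; rewrite PSeries_0; unfold a; simpl; field. }
assert (q0 : q 0 = 0%R).
{ unfold q; rewrite PSeries_0; unfold b; simpl; field. }
destruct (linear_ode_rotation al be p q Dp Dq p0 q0) as [Ep Eq].
apply is_Cseries_Re_Im; split.
- replace (Re (Cexp z)) with (p 1) by exact Ep.
  generalize (PSeries_correct _ _ (Ha 1%R)); apply is_series_ext; intro n.
  rewrite Cdiv_RtoC by apply INR_fact_neq_0.
  change (@pow_n R_Ring 1%R n * a n = a n)%R; rewrite pow_n_pow, pow1; ring.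
- replace (Im (Cexp z)) with (q 1) by exact Eq.
  generalize (PSeries_correct _ _ (Hb 1%R)); apply is_series_ext; intro n.
  rewrite Cdiv_RtoC by apply INR_fact_neq_0.
  change (@pow_n R_Ring 1%R n * b n = b n)%R; rewrite pow_n_pow, pow1; ring.
Qed.

(** * Exponential generating functions on the real axis *)

(** The power is taken in [R] before the embedding, so that each term splits into real and imaginary
    parts by scaling alone. *)
Definition real_axis_egf (f : R -> C) (c : nat -> C) : Prop :=
  exists rho : R, (0 < rho)%R /\ forall u : R, u <> 0%R -> (Rabs u < rho)%R ->
    is_Cseries (fun n => RtoC (u ^ n) * (c n / RtoC (INR (fact n)))) (f u).

Lemma has_egf_real_axis (f : C -> C) (c : nat -> C) :
  has_egf f c -> real_axis_egf (fun u => f (RtoC u)) c.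
Proof.
intros [rho [Hrho H]]; exists rho; split; [exact Hrho|]; intros u Hu Hur.
generalize (H (RtoC u)); rewrite Cmod_R; intro Hs.
apply is_Cseries_ext with (3 := Hs (fun E => Hu (RtoC_inj _ _ E)) Hur); [|easy].
intro n; now rewrite RtoC_pow.
Qed.

(** Agreement is asked only near 0 and off 0, since the identity of generating functions involves a
    quotient whose denominator may vanish elsewhere or at 0. *)
Lemma real_axis_egf_ext (f g : R -> C) (c : nat -> C) (rho : R) :
  (0 < rho)%R -> (forall u, u <> 0%R -> (Rabs u < rho)%R -> f u = g u) ->
  real_axis_egf f c -> real_axis_egf g c.
Proof.
intros Hrho Hfg [rho' [Hrho' H]]; exists (Rmin rho rho').
split; [now apply Rmin_pos|]; intros u Hu Hur.
rewrite <- Hfg; [apply H|..]; trivial;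
  eapply Rlt_le_trans; eauto; [apply Rmin_r|apply Rmin_l].
Qed.

Lemma real_axis_egf_scal (k : C) (f : R -> C) (c : nat -> C) :
  real_axis_egf f c -> real_axis_egf (fun u => k * f u) (fun n => k * c n).
Proof.
intros [rho [Hrho H]]; exists rho; split; [exact Hrho|]; intros u Hu Hur.
generalize (@is_series_scal C_AbsRing C_NormedModule k _ _ (H u Hu Hur)).
apply is_Cseries_ext; [|easy].
intro n; unfold scal; simpl; unfold mult; simpl; field; apply INR_fact_C_neq_0.
Qed.

Lemma real_axis_egf_plus (f g : R -> C) (c d : nat -> C) :
  real_axis_egf f c -> real_axis_egf g d ->
  real_axis_egf (fun u => f u + g u) (fun n => c n + d n).
Proof.
intros [rho [Hrho H]] [rho' [Hrho' H']]; exists (Rmin rho rho').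
split; [now apply Rmin_pos|]; intros u Hu Hur.
assert (Hl : (Rabs u < rho)%R) by (eapply Rlt_le_trans; [exact Hur|apply Rmin_l]).
assert (Hr : (Rabs u < rho')%R) by (eapply Rlt_le_trans; [exact Hur|apply Rmin_r]).
generalize (@is_series_plus C_AbsRing C_NormedModule _ _ _ _ (H u Hu Hl) (H' u Hu Hr)).
apply is_Cseries_ext; [|easy].
intro n; unfold plus; simpl; field; apply INR_fact_C_neq_0.
Qed.

Lemma real_axis_egf_Csum (f : nat -> R -> C) (c : nat -> nat -> C) (m : nat) :
  (forall j, real_axis_egf (f j) (c j)) ->
  real_axis_egf (fun u => Csum (fun j => f j u) m) (fun n => Csum (fun j => c j n) m).
Proof.
intro H; unfold Csum; induction m as [|m IH].
- destruct (H O) as [rho [Hrho H0]]; exists rho; split; [exact Hrho|].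
  intros u Hu Hur; rewrite sum_O; apply is_Cseries_ext with (3 := H0 u Hu Hur); [|easy].
  intro n; now rewrite sum_O.
- destruct (real_axis_egf_plus _ _ _ _ IH (H (S m))) as [rho [Hrho H0]].
  exists rho; split; [exact Hrho|].
  intros u Hu Hur; rewrite sum_Sn; apply is_Cseries_ext with (3 := H0 u Hu Hur); [|easy].
  intro n; now rewrite sum_Sn.
Qed.

(** [pr] stands for [Re] or [Im], so that one computation of Cauchy products serves both. *)
Definition egf_component (pr : C -> R) (c : nat -> C) (n : nat) : R :=
  (pr (c n) / INR (fact n))%R.

Lemma real_axis_egf_Re_Im (f : R -> C) (c : nat -> C) :
  real_axis_egf f c <->
  exists rho : R, (0 < rho)%R /\ forall u : R, u <> 0%R -> (Rabs u < rho)%R ->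
    is_pseries (egf_component Re c) u (Re (f u)) /\
    is_pseries (egf_component Im c) u (Im (f u)).
Proof.
assert (ER : forall u n, scal (pow_n u n) (egf_component Re c n) =
  Re (RtoC (u ^ n) * (c n / RtoC (INR (fact n))))).
{ intros u n; rewrite Re_scal, Cdiv_RtoC by apply INR_fact_neq_0.
  now rewrite <- pow_n_pow. }
assert (EI : forall u n, scal (pow_n u n) (egf_component Im c n) =
  Im (RtoC (u ^ n) * (c n / RtoC (INR (fact n))))).
{ intros u n; rewrite Im_scal, Cdiv_RtoC by apply INR_fact_neq_0.
  now rewrite <- pow_n_pow. }
split; intros [rho [Hrho H]]; exists rho; (split; [exact Hrho|]); intros u Hu Hur.
- destruct (proj1 (is_Cseries_Re_Im _ _) (H u Hu Hur)) as [HR HI]; split.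
  + revert HR; apply is_series_ext; intro n; now rewrite <- ER.
  + revert HI; apply is_series_ext; intro n; now rewrite <- EI.
- destruct (H u Hu Hur) as [HR HI]; apply is_Cseries_Re_Im; split.
  + revert HR; apply is_series_ext; intro n; now rewrite <- ER.
  + revert HI; apply is_series_ext; intro n; now rewrite <- EI.
Qed.

(** The midpoint of [Rabs u] and [rho] is a nonzero point of convergence strictly beyond [u], even
    when [u = 0]. *)
Lemma punctured_CV_radius (a : nat -> R) (rho u : R) :
  (Rabs u < rho)%R ->
  (forall v, v <> 0%R -> (Rabs v < rho)%R -> ex_pseries a v) ->
  Rbar_lt (Rabs u) (CV_radius a).
Proof.
intros Hu H; pose proof (Rabs_pos u).
assert (E : Rabs ((Rabs u + rho) / 2) = ((Rabs u + rho) / 2)%R)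
  by (apply Rabs_pos_eq; lra).
apply CV_radius_gt with ((Rabs u + rho) / 2)%R; [|apply H]; try rewrite E; lra.
Qed.

(* Multiplying both series by u makes them agree at u = 0 too. *)
Lemma punctured_pseries_unique (a b : nat -> R) (g : R -> R) (rho : R) :
  (0 < rho)%R ->
  (forall u, u <> 0%R -> (Rabs u < rho)%R -> is_pseries a u (g u)) ->
  (forall u, u <> 0%R -> (Rabs u < rho)%R -> is_pseries b u (g u)) ->
  forall n, a n = b n.
Proof.
intros Hrho Ha Hb n; change (PS_incr_1 a (S n) = PS_incr_1 b (S n)).
assert (HC : forall c, (forall u, u <> 0%R -> (Rabs u < rho)%R -> is_pseries c u (g u)) ->
  Rbar_lt 0 (CV_radius (PS_incr_1 c))).
(* The shift leaves the radius unchanged, so convergence off 0 is enough. *)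
{ intros c Hc; rewrite CV_radius_incr_1, <- Rabs_R0; apply punctured_CV_radius with rho.
  - now rewrite Rabs_R0.
  - intros v Hv Hvr; exists (g v); now apply Hc. }
apply PSeries_ext_recip; [now apply HC|now apply HC|].
exists (mkposreal rho Hrho); intros u Hu.
assert (Hur : (Rabs u < rho)%R).
{ revert Hu; unfold ball; simpl; unfold AbsRing_ball, abs, minus, plus, opp; simpl.
  now rewrite Ropp_0, Rplus_0_r. }
rewrite !PSeries_incr_1; destruct (Req_dec u 0) as [->|Hu0]; [ring|].
now rewrite (is_pseries_unique _ _ _ (Ha u Hu0 Hur)), (is_pseries_unique _ _ _ (Hb u Hu0 Hur)).
Qed.

Lemma real_axis_egf_unique (f : R -> C) (c d : nat -> C) :
  real_axis_egf f c -> real_axis_egf f d -> forall n, c n = d n.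
Proof.
intros Hc Hd n.
apply real_axis_egf_Re_Im in Hc; destruct Hc as [rho [Hrho H]].
apply real_axis_egf_Re_Im in Hd; destruct Hd as [rho' [Hrho' H']].
assert (Hm := Rmin_pos _ _ Hrho Hrho').
assert (Hl : forall u, (Rabs u < Rmin rho rho')%R -> (Rabs u < rho)%R)
  by (intros; eapply Rlt_le_trans; [eassumption|apply Rmin_l]).
assert (Hr : forall u, (Rabs u < Rmin rho rho')%R -> (Rabs u < rho')%R)
  by (intros; eapply Rlt_le_trans; [eassumption|apply Rmin_r]).
assert (E : forall x y : R, (x / INR (fact n) = y / INR (fact n))%R -> x = y).
{ intros x y Hxy; apply Rmult_eq_reg_r with (1 := Hxy).
  apply Rinv_neq_0_compat, INR_fact_neq_0. }
apply injective_projections; apply E.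
- apply (punctured_pseries_unique (egf_component Re c) (egf_component Re d)
    (fun u => Re (f u)) _ Hm); intros; [apply H|apply H']; auto.
- apply (punctured_pseries_unique (egf_component Im c) (egf_component Im d)
    (fun u => Im (f u)) _ Hm); intros; [apply H|apply H']; auto.
Qed.

(** * Multiplication by a real exponential *)

Lemma Cexp_RtoC (u : R) : Cexp (RtoC u) = RtoC (exp u).
Proof.
unfold Cexp; simpl; rewrite cos_0, sin_0; unfold RtoC; f_equal; ring.
Qed.

Lemma is_pseries_exp_scaled (j u : R) :
  is_pseries (fun n => j ^ n / INR (fact n))%R u (exp (j * u)).
Proof.
generalize (is_exp_Reals (j * u)); apply is_series_ext; intro n.
unfold scal; simpl; unfold mult; simpl; rewrite (pow_n_pow u), (pow_n_pow (j * u)%R), Rpow_mult_distr.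
field; apply INR_fact_neq_0.
Qed.

(** In the Cauchy product, the denominators [fact l] and [fact (n - l)] measured against [fact n]
    form the binomial coefficient. *)
Lemma Csum_binomial_component (pr : C -> R) (j : R) (c : nat -> C) (n : nat) :
  PS_mult (egf_component pr c) (fun i => j ^ i / INR (fact i))%R n =
  (sum_n (fun l => j ^ (n - l) * Binomial.C n l * pr (c l))%R n / INR (fact n))%R.
Proof.
unfold PS_mult; rewrite <- sum_n_Reals.
etransitivity; [|exact (@sum_n_mult_r R_Ring (/ INR (fact n))%R _ n)].
apply sum_n_ext_loc; intros l Hl; unfold mult; simpl; unfold egf_component, Binomial.C.
field; repeat split; apply INR_fact_neq_0.
Qed.

(** For real [u] the exponential factor is real, so it multiplies each component separately and two
    real Cauchy products suffice. For [j = 0] only the term [l = n] survives, with [0 ^ 0 = 1], and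
    the sum is [c n]. *)
Lemma real_axis_egf_mul_exp (j : R) (f : R -> C) (c : nat -> C) :
  real_axis_egf f c ->
  real_axis_egf (fun u => RtoC (exp (j * u)) * f u)
    (fun n => Csum (fun l => RtoC j ^ (n - l) * RtoC (Binomial.C n l) * c l) n).
Proof.
intro Hc; apply real_axis_egf_Re_Im; apply real_axis_egf_Re_Im in Hc.
destruct Hc as [rho [Hrho H]]; exists rho; split; [exact Hrho|]; intros u Hu Hur.
(* The product theorem needs [u] strictly inside both disks of convergence. *)
assert (He : Rbar_lt (Rabs u) (CV_radius (fun n => j ^ n / INR (fact n))%R)).
{ apply CV_radius_entire; intro y; eexists; apply is_pseries_exp_scaled. }
assert (E : forall n l, RtoC j ^ (n - l) * RtoC (Binomial.C n l) * c l =
  RtoC (j ^ (n - l) * Binomial.C n l)%R * c l).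
{ intros; now rewrite RtoC_mult, RtoC_pow. }
destruct (H u Hu Hur) as [HR HI]; split.
- rewrite Re_scal, Rmult_comm.
  assert (Hr : Rbar_lt (Rabs u) (CV_radius (egf_component Re c))).
  { apply punctured_CV_radius with rho; [exact Hur|].
    intros v Hv Hvr; eexists; apply H; assumption. }
  generalize (is_pseries_mult _ _ _ _ _ HR (is_pseries_exp_scaled j u) Hr He).
  apply is_pseries_ext; intro n; rewrite Csum_binomial_component.
  unfold egf_component; f_equal; unfold Csum; rewrite sum_n_C.
  apply sum_n_ext; intro l; now rewrite E, Re_scal.
- rewrite Im_scal, Rmult_comm.
  assert (Hr : Rbar_lt (Rabs u) (CV_radius (egf_component Im c))).
  { apply punctured_CV_radius with rho; [exact Hur|].
    intros v Hv Hvr; eexists; apply H; assumption. }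
  generalize (is_pseries_mult _ _ _ _ _ HI (is_pseries_exp_scaled j u) Hr He).
  apply is_pseries_ext; intro n; rewrite Csum_binomial_component.
  unfold egf_component; f_equal; unfold Csum; rewrite sum_n_C.
  apply sum_n_ext; intro l; now rewrite E, Im_scal.
Qed.

(** * The two generating functions *)

Lemma egf_coeff_spec (f : C -> C) : analytic_near_0 f -> has_egf f (egf_coeff f).
Proof. apply epsilon_spec. Qed.

(** This gives the analyticity of the generating function of [P]: the exponential series is shifted
    by [m] places and scaled by [K]. The factor [fact n] in the witness undoes the division in
    [has_egf]. *)
Lemma analytic_monomial_Cexp (K y : C) (m : nat) :
  analytic_near_0 (fun t => K * t ^ m * Cexp (t * y)).
Proof.
set (e := fun n => y ^ n / RtoC (INR (fact n))).
exists (fun n => RtoC (INR (fact n)) *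
  (K * @PS_incr_n C_AbsRing C_NormedModule e m n)).
(* The series converges for every [t], so the radius 1 is arbitrary. *)
exists 1%R; split; [lra|]; intros t _ _.
assert (He : @is_pseries C_AbsRing C_NormedModule e t (Cexp (t * y))).
{ apply is_Cseries_ext with (3 := is_Cseries_Cexp (t * y)); [|easy].
  intro n; change (@scal C_AbsRing C_NormedModule (pow_n t n) (e n)) with (t ^ n * e n).
  unfold e; rewrite Cpow_mult_l; field; apply INR_fact_C_neq_0. }
apply (is_pseries_incr_n _ m) in He.
apply (@is_pseries_scal C_AbsRing C_NormedModule K _ _ _ (Cmult_comm _ _)) in He.
apply is_Cseries_ext with (3 := He).
- intro n; unfold PS_scal, scal; simpl; unfold mult; simpl; field.
  apply INR_fact_C_neq_0.
- change (K * (t ^ m * Cexp (t * y)) = K * t ^ m * Cexp (t * y)); ring.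
Qed.

(** * Algebra of finite products, sums and powers *)

Lemma Cprod_ext (r : nat) (f g : nat -> C) :
  (forall i, (i < r)%nat -> f i = g i) -> Cprod r f = Cprod r g.
Proof.
induction r as [|r IH]; intro H; [easy|]; simpl.
rewrite IH, H; [easy|lia|intros; apply H; lia].
Qed.

Lemma Cprod_mult (r : nat) (f g : nat -> C) :
  Cprod r f * Cprod r g = Cprod r (fun i => f i * g i).
Proof. induction r as [|r IH]; simpl; [|rewrite <- IH]; ring. Qed.

Lemma Csum_ext (f g : nat -> C) (n : nat) :
  (forall i, f i = g i) -> Csum f n = Csum g n.
Proof. apply (@sum_n_ext C_AbelianMonoid). Qed.

Lemma Csum_mult_l (K : C) (f : nat -> C) (n : nat) :
  K * Csum f n = Csum (fun i => K * f i) n.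
Proof. symmetry; apply (@sum_n_mult_l C_Ring). Qed.

Lemma exp_INR_mult (m : nat) (u : R) : exp (INR m * u) = (exp u ^ m)%R.
Proof.
induction m as [|m IH]; [now rewrite Rmult_0_l, exp_0|].
rewrite S_INR, Rmult_plus_distr_r, Rmult_1_l, exp_plus, IH; simpl; ring.
Qed.

Lemma powerRZ_2_mult (r : nat) (z : Z) :
  powerRZ 2 (Z.of_nat r * z) = (powerRZ 2 z ^ r)%R.
Proof.
induction r as [|r IH]; [easy|].
rewrite Nat2Z.inj_succ, Z.mul_succ_l, powerRZ_add, IH by lra; simpl; ring.
Qed.

(** The shape fits [analytic_monomial_Cexp], and the power of two is written as in [M_gf] so that
    the two match in the final comparison. *)
Lemma P_gf_monomial (a b x : R) (k r : nat) (t : C) :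
  (1 + a * x <> 0)%R ->
  P_gf a b x k r t =
  RtoC (powerRZ 2 (Z.of_nat r * (1 - Z.of_nat k)) * (x / (1 + a * x)) ^ (r * k)
    / INR (fact (r * k)))
  * t ^ (r * k) * Cexp (t * RtoC ((1 + b * x) / (1 + a * x))).
Proof.
intro Hx; unfold P_gf.
assert (Hx' : RtoC (1 + a * x) <> 0) by (intro E; now apply Hx, RtoC_inj).
rewrite powerRZ_2_mult; set (d := (1 + a * x)%R) in *; set (y := RtoC ((1 + b * x) / d)).
rewrite RtoC_div by apply INR_fact_neq_0.
rewrite RtoC_mult, !RtoC_pow, RtoC_div by exact Hx.
set (T := RtoC (powerRZ 2 (1 - Z.of_nat k))).
replace (T * RtoC x ^ k * t ^ k / RtoC d ^ k) with (T * (RtoC x / RtoC d * t) ^ k).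
2:{ unfold Cdiv; rewrite !Cpow_mult_l, Cpow_inv by exact Hx'; ring. }
rewrite (Nat.mul_comm r k), !Cpow_mult_r, !Cpow_mult_l; field.
apply INR_fact_C_neq_0.
Qed.

(* exp is injective on R, so each factor vanishes at no more than one real point. *)
Lemma M_gf_denominator_neq_0 (r : nat) (alpha : nat -> C) :
  exists rho : R, (0 < rho)%R /\ forall u : R, u <> 0%R -> (Rabs u < rho)%R ->
    Cprod r (fun i => alpha i * Cexp (RtoC u) - 1) <> 0.
Proof.
induction r as [|r [rho [Hrho IH]]].
- exists 1%R; split; [lra|]; intros u _ _ E; apply RtoC_inj in E; lra.
(* A nonzero real root [v] of the new factor caps the radius at [Rabs v]; a root at 0 is already
   excluded by [u <> 0]. *)
- destruct (classic (exists v, v <> 0%R /\ alpha r * Cexp (RtoC v) - 1 = 0))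
    as [[v [Hv Ev]]|Hno].
  + exists (Rmin rho (Rabs v)); split; [apply Rmin_pos; [easy|now apply Rabs_pos_lt]|].
    intros u Hu Hur; simpl; apply Cmult_neq_0.
    { apply IH; [easy|]; eapply Rlt_le_trans; [exact Hur|apply Rmin_l]. }
    (* If [alpha r] were 0, the factor would be [-1] and have no root. *)
    intro Eu; assert (Hne : alpha r <> 0).
    { intro E0; rewrite E0, Cmult_0_l in Ev.
      apply (f_equal fst) in Ev; simpl in Ev; lra. }
    assert (E : alpha r * RtoC (exp u) = alpha r * RtoC (exp v)).
    { rewrite <- !Cexp_RtoC.
      replace (alpha r * Cexp (RtoC u)) with (alpha r * Cexp (RtoC u) - 1 + 1) by ring.
      rewrite Eu, <- Ev; ring. }
    apply (Rlt_not_le _ _ Hur); replace u with v; [apply Rmin_r|].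
    { symmetry; apply exp_inv, RtoC_inj.
      replace (RtoC (exp u)) with (/ alpha r * (alpha r * RtoC (exp u))) by (now field).
      rewrite E; now field. }
  + exists rho; split; [easy|]; intros u Hu Hur; simpl; apply Cmult_neq_0.
    { now apply IH. }
    intro E; apply Hno; now exists u.
Qed.

(** Factor by factor, [alpha i * (z - / alpha i) = alpha i * z - 1]. *)
Lemma Cprod_stirling1 (r : nat) (alpha : nat -> C) (z : C) :
  (forall i, (i < r)%nat -> alpha i <> 0) ->
  Cprod r alpha * Csum (fun j => stirling1 r j (fun i => / alpha i) * z ^ j) r =
  Cprod r (fun i => alpha i * z - 1).
Proof.
intro H; rewrite <- (stirling1_spec r (fun i => / alpha i) z), Cprod_mult.
apply Cprod_ext; intros i Hi; field; now apply H.
Qed.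

Theorem theorem4p7
  (k r : nat) (hk : (1 <= k)%nat) (hr : (1 <= r)%nat)
  (a b x : R) (hx : (1 + a * x <> 0)%R)
  (alpha : nat -> C) (halpha : forall i : nat, (i < r)%nat -> alpha i <> 0)
  (hM : analytic_near_0
          (M_gf r (RtoC ((1 + b * x) / (1 + a * x))) k alpha))
  (n : nat) :
  P a b n x k r =
    Cprod r alpha / RtoC (INR (fact (r * k)))
    * RtoC (x / (1 + a * x)) ^ (r * k)
    * Csum (fun j : nat =>
        stirling1 r j (fun i : nat => / alpha i)
        * Csum (fun l : nat =>
            RtoC (INR j) ^ (n - l) * RtoC (Binomial.C n l)
            * M r l (RtoC ((1 + b * x) / (1 + a * x))) k alpha) n) r.
Proof.
set (y := RtoC ((1 + b * x) / (1 + a * x))).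
assert (HP : real_axis_egf (fun u => P_gf a b x k r (RtoC u)) (fun n => P a b n x k r)).
{ apply has_egf_real_axis, egf_coeff_spec.
  destruct (analytic_monomial_Cexp
    (RtoC (powerRZ 2 (Z.of_nat r * (1 - Z.of_nat k)) * (x / (1 + a * x)) ^ (r * k)
      / INR (fact (r * k)))) y (r * k)) as [c [rho [Hrho Hc]]].
  exists c, rho; split; [exact Hrho|]; intros t Ht Htr.
  rewrite P_gf_monomial by exact hx; now apply Hc. }
assert (HMr := has_egf_real_axis _ _ (egf_coeff_spec _ hM)).
set (K := Cprod r alpha / RtoC (INR (fact (r * k))) * RtoC (x / (1 + a * x)) ^ (r * k)).
(* The coefficient sequence of [HS] is the right-hand side of the claim. *)
assert (HS := real_axis_egf_scal K _ _ (real_axis_egf_Csum _ _ r (fun j =>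
  real_axis_egf_scal (stirling1 r j (fun i => / alpha i)) _ _
    (real_axis_egf_mul_exp (INR j) _ _ HMr)))).
(* By uniqueness it remains to identify the two functions at real [u <> 0] so small that the
   denominator of [M_gf] is nonzero. *)
revert n; refine (real_axis_egf_unique _ _ _ HP _).
destruct (M_gf_denominator_neq_0 r alpha) as [rho [Hrho Hne]].
refine (real_axis_egf_ext _ _ _ rho Hrho _ HS); intros u Hu Hur.
set (Mu := M_gf r y k alpha (RtoC u)).
transitivity (K * Mu *
  Csum (fun j => stirling1 r j (fun i => / alpha i) * Cexp (RtoC u) ^ j) r).
{ rewrite <- Cmult_assoc, (Csum_mult_l Mu); apply (f_equal (Cmult K)), Csum_ext; intro j.
  rewrite Cexp_RtoC, <- RtoC_pow, <- exp_INR_mult; unfold Mu, y; ring. }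
rewrite P_gf_monomial by exact hx.
pose proof (Cprod_stirling1 r alpha (Cexp (RtoC u)) halpha) as E.
pose proof (Hne u Hu Hur) as HD; rewrite <- E in HD.
unfold Mu, M_gf, K; rewrite <- E; fold y; rewrite (Cmult_comm (RtoC u) y).
set (q := (x / (1 + a * x))%R).
rewrite RtoC_div, RtoC_mult, RtoC_pow by apply INR_fact_neq_0.
set (A := Cprod r alpha) in *; set (S := Csum _ r) in *.
(* The denominator of [M_gf] is now [A * S]; a vanishing factor would contradict [HD]. *)
field; repeat split; [apply INR_fact_C_neq_0|intro Z; apply HD; rewrite Z; ring..].
Qed.
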